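(* Let $n \ge 1$ be an integer, let $\zeta, d > 0$ be real numbers (which may depend on $n$), and let $G$ be a $(\zeta,d)$-dense graph with $n$ vertices. Let $D \ge 1$ be an integer, put $f := \frac{4D}{d}\log(1/\zeta)$, and let $s$ be an integer with $s \ge f$. Here $f$ and $\zeta n$ are understood to be integers. Then there are at most $$\binom{n}{f}\binom{\zeta n}{s-f}$$ subsets $U \subseteq V(G)$ of size $|U| = s$ such that $\Delta(G[U]) < D$.
   Context: All graphs are finite and simple. For $S \subseteq V(G)$, $G[S]$ is the subgraph of $G$ induced by $S$, $e(\cdot)$ denotes the number of edges and $\Delta(\cdot)$ the maximum degree. An $n$-vertex graph $G$ is $(\zeta,d)$-dense, for $\zeta,d>0$, if for every $S \subseteq V(G)$ of size $|S| \ge \zeta n$ we have $e(G[S]) \ge d|S|^2/2$. The logarithm is to base $2$. *)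

(* Defs.v *)
From HB Require Import structures.
From mathcomp Require Import all_boot all_order all_algebra.
From mathcomp Require Import reals exp.

Set Implicit Arguments.
Unset Strict Implicit.
Unset Printing Implicit Defensive.

Import Order.TTheory GRing.Theory Num.Theory.

Record sgraph (V : finType) := SGraph {
  adj : rel V;
  adj_sym : symmetric adj;
  adj_irr : irreflexive adj
}.

Section Graph.
Variable V : finType.
Implicit Types (G : sgraph V) (S : {set V}).

Section Induced.
Variables (G : sgraph V) (S : {set V}).

Let iadj : rel {x : V | x \in S} := fun x y => adj G (val x) (val y).

Fact iadj_sym : symmetric iadj.
Proof. by move=> x y; apply: adj_sym. Qed.

Fact iadj_irr : irreflexive iadj.
Proof. by move=> x; apply: adj_irr. Qed.

Definition induced : sgraph {x : V | x \in S} := SGraph iadj_sym iadj_irr.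

End Induced.

Definition edge_set G : {set {set V}} :=
  [set E : {set V} | [exists x, exists y, adj G x y && (E == [set x; y])]].

Definition num_edges G : nat := #|edge_set G|.

Definition degree G (v : V) : nat := #|[set w | adj G v w]|.

(* The maximum degree of the graph with no vertices is 0. *)
Definition max_degree G : nat := \max_(v : V) degree G v.

End Graph.

Local Open Scope ring_scope.

Definition dense (R : realType) (V : finType) (G : sgraph V) (zeta d : R) :=
  forall S : {set V}, zeta * #|V|%:R <= #|S|%:R ->
    d * #|S|%:R ^+ 2 / 2 <= (num_edges (induced G S))%:R.

Definition log2 (R : realType) (x : R) : R := ln x / ln 2.

(* Main.v *)
Require Import Defs.
From mathcomp Require Import all_boot all_order all_algebra.
From mathcomp Require Import reals sequences exp.
From mathcomp Require Import zify ring lra.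

(** Write x = n - m and r = s - f, where m = zeta n, and call U low if all degrees
in G[U] are less than D.

The proof follows the container method. Keep a container A, initially V, and a
fingerprint T, initially empty, such that U lies between T and their union. As
long as |A| > m, density provides a vertex v with at least d |A| neighbours in A.
If v is not in U, delete it from A; otherwise move it to T and delete from A every
vertex that has now received D selected neighbours, as it cannot belong to a low
set. When |T| = f or |A| <= m the procedure stops. There are at most C(n, f)
fingerprints, so it is enough that every fingerprint belongs to at most C(m, r) low
sets; [card_low_degree_sets] carries out this recursion, one Pascal step at a time.
If |A| <= m at the end, the bound is clear: the f - |T| missing elements of the
fingerprint and the r other elements of U are all taken from A.

If n/m > 13/10, this always happens ([fingerprint_exhausted]). Give u the weight
w u, the number of its neighbours selected while u was in A. The average over A of
D - w, plus D ln |A|, decreases by at least d at every selection and never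
increases when vertices are deleted. This allows at most (D/d) (1 + ln (n/m))
selections, which is less than f.

If n/m is close to 1, the procedure may select f vertices while A is still
larger than m: f is then of order (x/n) D/d, and no vertex need have received D
selected neighbours. Two different arguments take over, according to the average
number s x / n of elements of U in an x-set. If s x <= f (n + 1), the bound holds for the
family of all s-sets ([bin_le_mul_bin]). Otherwise U is so large that being low is
exceptional. The f selected vertices have sent total weight at least
d f m = 4 D m log2 (n/m), more than 4 D x, into V, while U receives weight
at most f D, as each selected vertex has fewer than D neighbours in U. So
a low set with this fingerprint is a set of size s whose weight is far below the
average one. Their number is bounded by repeatedly deleting a vertex drawn with
probability proportional to its weight, which most of these sets avoid
([light_subsets_le]); after 2x deletions the remaining ground set is so much
smaller than m that the bound C(m, r) survives the accumulated losses
([expn_mul_bin_le], [card_low_degree_sets_heavy]). *)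

Set Implicit Arguments.
Unset Strict Implicit.
Unset Printing Implicit Defensive.

Import Order.TTheory GRing.Theory Num.Theory.

Local Open Scope ring_scope.

(** * Estimates of the logarithm *)

Lemma ln_ge1BV (R : realType) (x : R) : 0 < x -> 1 - x^-1 <= ln x.
Proof.
move=> x_gt0; rewrite -[ln x]opprK -lnV ?posrE// lerNr opprB.
have -> : x^-1 = 1 + (x^-1 - 1) by ring.
rewrite [leRHS](_ : _ = x^-1 - 1); last by ring.
by apply: le_ln1Dx; have := invr_gt0 x; rewrite x_gt0 => ?; lra.
Qed.

Lemma ln2_le (R : realType) : ln 2 <= 7 / 10 :> R.
Proof.
rewrite -(expRK (7 / 10 : R)) ler_ln ?posrE ?expR_gt0//.
(* Each step halves the argument; the fractions are lower approximations of
   exp (7/20), exp (7/40), and so on, until 1 + x <= expR x is sharp enough. *)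
have half (z y x : R) : 0 <= y -> z <= y * y -> y <= expR (x / 2) -> z <= expR x.
  move=> y0 zyy yx; rewrite [x]splitr expRD.
  by apply: le_trans zyy _; apply: ler_pM.
apply: (half _ (695 / 491)); [lra|lra|].
apply: (half _ (232 / 195)); [lra|lra|].
apply: (half _ (649 / 595)); [lra|lra|].
apply: (half _ (588 / 563)); [lra|lra|].
apply: (half _ (93 / 91)); [lra|lra|].
apply: (half _ (1 + 7 / 640)); [lra|lra|].
apply: le_trans (expR_ge1Dx _); lra.
Qed.

Lemma ln_div_ln2_ge (R : realType) (l : R) : 0 <= l -> 10 / 7 * l <= l / ln 2.
Proof.
move=> l0; rewrite mulrC ler_wpM2l// -[10 / 7]invf_div.
by rewrite lef_pV2 ?posrE ?ln2_le ?ln_gt0 ?ltr1n//; lra.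
Qed.

Lemma ln1D_ge (R : realType) (t : R) : 0 <= t <= 3 / 10 ->
  7 / 10 * (t + t ^+ 2 / 2) <= ln (1 + t).
Proof.
move=> /andP[t0 t1].
(* The bound 1 - 1/z <= ln z is too weak at z = 1 + t; splitting the interval
   from 1 to 1 + t in the middle makes it sufficient. *)
have -> : 1 + t = (1 + t) / (1 + t / 2) * (1 + t / 2) by field; lra.
have h : 0 < 1 + t / 2 by lra.
have h1 : 0 < 1 + t by lra.
rewrite lnM ?posrE ?divr_gt0//.
have := lerD (ln_ge1BV (divr_gt0 h1 h)) (ln_ge1BV h).
apply: le_trans; rewrite -subr_ge0.
have -> : 1 - ((1 + t) / (1 + t / 2))^-1 + (1 - (1 + t / 2)^-1) -
   7 / 10 * (t + t ^+ 2 / 2) = t / 2 *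
     (4 + 3 * t - 7 / 10 * (2 + t) ^+ 2 * (1 + t)) / ((1 + t) * (2 + t)).
  by field; rewrite !lt0r_neq0//; lra.
apply: divr_ge0; last by apply: mulr_ge0; lra.
apply: mulr_ge0; first lra.
nra.
Qed.

(** * Binomial coefficients *)

(** In a random x-subset of an n-set, a fixed s-set has s * x / n elements on
average. When this is at most f, forgetting the condition on the degrees costs
nothing: a random s-set is likely enough to meet a fixed x-set in f elements.
The proof compares the growth of both sides in s, from the trivial case s = f. *)
Lemma bin_le_mul_bin (n f x s : nat) : (f <= s)%N -> (s * x <= f * n.+1)%N ->
  (x <= n)%N -> ('C(n, s) <= 'C(n, f) * 'C(n - x, s - f))%N.
Proof.
move=> fs; rewrite -(subnKC fs); move: (s - f)%N => r {s fs} hx xn.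
rewrite addKn; elim: r hx => [|r IHr] hx; first by rewrite addn0 bin0 muln1.
have {}IHr := IHr (leq_trans (leq_mul (leq_add (leqnn f) (leqnSn r)) (leqnn x)) hx).
rewrite -(@leq_pmul2l ((f + r).+1 * r.+1)) ?muln_gt0//.
rewrite addnS mulnAC mul_bin_left.
rewrite [leqRHS](_ : _ = (f + r).+1 * 'C(n, f) * (r.+1 * 'C(n - x, r.+1)))%N; last by lia.
rewrite mul_bin_left.
have [nfr|frn] := leqP n (f + r).
  by rewrite (eqP (_ : n - (f + r) == 0)%N) ?subn_eq0.
(* Passing from s to s+1 multiplies the right-hand side by at least as much as
   the left-hand side; this is where the hypothesis on s * x is spent. *)
have key : ((n - (f + r)) * r.+1 <= (f + r).+1 * (n - x - r))%N.
  rewrite addnS in hx.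
  have [?|?] := leqP r (n - x); last nia.
  have e1 : (n - (f + r) + (f + r) = n)%N by lia.
  have e2 : (n - x - r + x + r = n)%N by lia.
  move: (n - (f + r))%N (n - x - r)%N e1 e2 => p q; nia.
have := leq_mul key IHr; lia.
Qed.

(** A set of j + r elements is the union of a j-set and an r-set. *)
Lemma binD_le (a j r : nat) : ('C(a, j + r) <= 'C(a, j) * 'C(a, r))%N.
Proof.
elim: r => [|r IHr]; first by rewrite addn0 bin0 muln1.
rewrite -(@leq_pmul2l (j + r).+1)// addnS mul_bin_left.
apply: (@leq_trans ((a - r) * ('C(a, j) * 'C(a, r)))).
  by rewrite leq_mul// leq_sub2l ?leq_addl.
by rewrite mulnCA -mul_bin_left mulnCA !leq_mul// ltnS leq_addl.
Qed.

(** Removing one point from a ground set of c <= b points kills a proportion at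
least r / b of its r-subsets. *)
Lemma bin_decay (R : realType) (b c r i : nat) : (0 < b)%N -> (c <= b)%N ->
  (i <= c)%N -> 'C(c - i, r)%:R <= 'C(c, r)%:R * expR (- (r%:R / b%:R * i%:R) : R).
Proof.
move=> b0 cb; elim: i => [|i IHi] ic; first by rewrite subn0 mulr0 oppr0 expR0 mulr1.
have {}IHi := IHi (ltnW ic).
have b0' : 0 < b%:R :> R by rewrite ltr0n.
rewrite -natr1 mulrDr mulr1 opprD expRD mulrA.
apply: le_trans (_ : 'C(c - i, r)%:R * expR (- (r%:R / b%:R)) <= _); last first.
  by rewrite ler_wpM2r ?expR_ge0.
have ci0 : 0 < (c - i)%:R :> R by rewrite ltr0n subn_gt0.
rewrite -(ler_pM2l ci0) subnS -natrM mul_bin_down natrM [leRHS]mulrCA [leLHS]mulrC.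
apply: ler_wpM2l => //.
have [rci|cir] := leqP r (c - i); last first.
  by rewrite (eqP (_ : c - i - r == 0)%N) ?subn_eq0 1?ltnW// mulr_ge0 ?expR_ge0.
rewrite natrB//; apply: le_trans (_ : (c - i)%:R * (1 + - (r%:R / b%:R)) <= _).
  rewrite mulrDr mulr1 lerD2l mulrN lerN2 mulrA ler_pdivrMr//.
  by rewrite mulrC ler_wpM2l// ler_nat; lia.
by rewrite ler_wpM2l// expR_ge1Dx.
Qed.

(** * Subsets of small weight *)

(** A set W of weight at most q in a ground set B that is much heavier than q
misses a vertex of B chosen with probability proportional to w with probability
at least 1 - q / w(B). So some u in B has the property that at least this
proportion of the light sets avoid u. Deleting k such vertices in turn leaves
r-subsets of a set of size |B| - k, at the price of a factor (1 + q/L) ^ k, where L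
bounds from below the excess of the weight over q before the last deletion. *)
Lemma light_subsets_le (R : realType) (V : finType) (w : V -> nat) (D : nat)
    (q L : R) (r k : nat) (B : {set V}) :
  (forall u, (w u <= D)%N) -> 0 <= q -> 0 < L ->
  L + q + k%:R * D%:R <= (\sum_(u in B) w u)%:R + D%:R ->
  #|[set W : {set V} | [&& W \subset B, #|W| == r &
      (\sum_(u in W) w u)%:R <= q]]|%:R <= (1 + q / L) ^+ k * 'C(#|B| - k, r)%:R.
Proof.
move=> wD q0 L0; elim: k B => [|k IHk] B hB.
  rewrite expr0 mul1r subn0 ler_nat -cards_draws subset_leq_card//.
  by apply/subsetP=> W; rewrite !inE => /and3P[-> ->].
set F := fun B' : {set V} => [set W : {set V} | [&& W \subset B', #|W| == r &
      (\sum_(u in W) w u)%:R <= q]].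
rewrite -/(F B); set M := (1 + q / L) ^+ k * 'C(#|B| - k.+1, r)%:R.
have z0 : 0 <= q / L by rewrite divr_ge0// ltW.
have IH u : u \in B -> #|F (B :\ u)|%:R <= M.
  move=> uB; rewrite /M [#|B|](cardsD1 u) uB subSS; apply: IHk.
  move: hB; rewrite (big_setD1 u)//= natrD -natr1.
  have : (w u)%:R <= D%:R :> R by rewrite ler_nat.
  by move=> ? ?; lra.
have M0 : 0 <= M by rewrite mulr_ge0// exprn_ge0// addr_ge0.
set wB : R := (\sum_(u in B) w u)%:R in hB.
have hwB : L + q <= wB.
  have : 0 <= k%:R * D%:R :> R by rewrite mulr_ge0.
  by move: hB; rewrite -natr1 mulrDl mul1r => ? ?; lra.
(* Count the pairs of a light set W and an element u of B outside W with
   multiplicity w u: every W misses weight at least w(B) - q. *)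
have dc : #|F B|%:R * (wB - q) <= wB * M.
  apply: (@le_trans _ _ (\sum_(W in F B) \sum_(u in B :\: W) (w u)%:R)).
    rewrite -sum1_card natr_sum mulr_suml; apply: ler_sum => W.
    rewrite inE mul1r => /and3P[WB _ wq].
    rewrite /wB (big_setID W)/= (setIidPr WB) natrD -natr_sum.
    lra.
  rewrite (exchange_big_dep (mem B))/=; last by move=> W u _; rewrite inE => /andP[].
  rewrite /wB natr_sum mulr_suml; apply: ler_sum => u uB.
  rewrite sumr_const -[_ *+ #|_|]mulr_natr ler_wpM2l//.
  apply: le_trans (IH u uB); rewrite ler_nat subset_leq_card//.
  apply/subsetP=> W /andP[]; rewrite !inE => /and3P[WB -> ->] /andP[uW _].
  by rewrite subsetD1 WB uW.
(* The ratio w(B) / (w(B) - q) decreases in w(B), and w(B) - q >= L. *)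
have pos : 0 < wB - q by lra.
rewrite exprS -mulrA -/M.
rewrite -(ler_pM2r pos); apply: le_trans dc _.
rewrite mulrAC ler_wpM2r//.
rewrite -subr_ge0 (_ : _ - _ = q * (wB - q - L) / L); last by field; lra.
by rewrite divr_ge0 ?mulr_ge0//; lra.
Qed.

(** The price in [light_subsets_le] for the k = 2x deletions is paid by the
gain of shrinking the ground set from m to m - (x + f) points. With b = m + x - f
the gain is exp (r (x + f) / b), the price at most exp (2 x z), and the condition
f (m + x) < s x makes r / b large enough: the difference of the two exponents,
once r and z are replaced by their bounds, has the sign of m (x - f) + 4 x^2. *)
Lemma expn_mul_bin_le (R : realType) (m x f s : nat) (z : R) :
  (f < x)%N -> (10 * x <= 3 * m)%N -> (f * (m + x) < s * x)%N -> (f <= s)%N ->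
  0 <= z -> z * (2 * x%:R + 2 * x%:R ^+ 2 / m%:R - f%:R) <= f%:R ->
  (1 + z) ^+ (2 * x) * 'C(m + x - f - 2 * x, s - f)%:R <= 'C(m, s - f)%:R.
Proof.
move=> fx xm fs fles z0 hz.
have m0 : (0 < m)%N by lia.
have -> : (m + x - f - 2 * x = m - (x + f))%N by lia.
set r := (s - f)%N.
have b0 : (0 < m + x - f)%N by lia.
have dec : 'C(m - (x + f), r)%:R <= _ :=
  @bin_decay R _ m r (x + f) b0 ltac:(lia) ltac:(lia).
apply: le_trans (ler_wpM2l _ dec) _; first by rewrite exprn_ge0// addr_ge0.
rewrite mulrCA ler_piMr//.
apply: (@le_trans _ _ (expR z ^+ (2 * x) *
  expR (- (r%:R / (m + x - f)%:R * (x + f)%:R)))).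
  rewrite ler_wpM2r ?expR_ge0// lerXn2r ?nnegrE ?expR_ge0 ?addr_ge0//.
  exact: expR_ge1Dx.
rewrite -expRM_natl -expRD -[leRHS](expR0 R) ler_expR subr_le0.
have X0 : 0 < x%:R :> R by rewrite ltr0n; lia.
have M0 : 0 < m%:R :> R by rewrite ltr0n.
have F0 : 0 <= f%:R :> R by [].
have FX : f%:R < x%:R :> R by rewrite ltr_nat.
have XM : 10 * x%:R <= 3 * m%:R :> R by rewrite -!natrM ler_nat.
have hr : f%:R * m%:R <= r%:R * x%:R :> R by rewrite -!natrM ler_nat; rewrite /r; nia.
clearbody r; rewrite natrB ?[(2 * x)%:R]natrM ?natrD; last by lia.
move: hz hr F0 FX XM X0 M0; move: (x%:R : R) (m%:R : R) (f%:R : R) (r%:R : R) => X M F Y.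
move=> hz hr F0 FX XM X0 M0.
have B0 : 0 < M + X - F by lra.
pose E := 2 * X + 2 * X ^+ 2 / M - F.
have E0 : 0 < E.
  have : 0 <= 2 * X ^+ 2 / M by rewrite divr_ge0 ?mulr_ge0 ?sqr_ge0// ltW.
  by rewrite /E; lra.
have zE : z <= F / E by rewrite ler_pdivlMr.
have YF : F * M / X <= Y by rewrite ler_pdivrMr.
apply: le_trans (_ : 2 * X * (F / E) <= _); first by rewrite ler_wpM2l// mulr_ge0// ltW.
apply: le_trans (_ : F * M / X / (M + X - F) * (X + F) <= _); last first.
  apply: ler_wpM2r; first lra.
  by apply: ler_wpM2r => //; rewrite invr_ge0 ltW.
rewrite -subr_ge0.
have -> : F * M / X / (M + X - F) * (X + F) - 2 * X * (F / E) =
   F ^+ 2 * (M * (X - F) + 4 * X ^+ 2) / (X * (M + X - F) * E).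
  rewrite /E; field.
  have hE : 2 * X * M + 2 * X ^+ 2 - F * M = E * M by rewrite /E; field; lra.
  by rewrite mulNr hE; apply/and4P; split; rewrite lt0r_neq0// mulr_gt0.
apply: divr_ge0; last by rewrite mulr_ge0 ?mulr_ge0// ltW.
rewrite mulr_ge0 ?sqr_ge0// addr_ge0 ?mulr_ge0 ?sqr_ge0//; lra.
Qed.

(** * Degrees and edges *)

Definition nbrs (V : finType) (G : sgraph V) (v : V) : {set V} :=
  [set u | adj G v u].

Lemma num_edges_le (V : finType) (G : sgraph V) :
  (2 * num_edges G <= \sum_v degree G v)%N.
Proof.
have edge2 E : E \in edge_set G -> #|E| = 2.
  rewrite inE => /existsP[x /existsP[y /andP[xy /eqP->]]].
  rewrite cards2; case: eqP xy => // ->; by rewrite adj_irr.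
(* Double counting of the pairs formed by an edge and one of its ends. *)
apply: (@leq_trans (\sum_(E in edge_set G) \sum_(v in E) 1)).
  rewrite (eq_bigr (fun=> 2)) => [|E /edge2 <-]; last by rewrite sum1_card.
  by rewrite sum_nat_const mulnC.
rewrite (exchange_big_dep predT)//=; apply: leq_sum => v _.
rewrite sum1_card.
apply: (@leq_trans #|[set [set v; w] | w in nbrs G v]|); last exact: leq_imset_card.
apply/subset_leq_card/subsetP=> E; rewrite unfold_in inE => /andP[].
move=> /existsP[x /existsP[y /andP[xy /eqP->]]]; rewrite !inE => /orP[]/eqP ->.
  by apply: imset_f; rewrite inE.
by rewrite setUC; apply: imset_f; rewrite inE adj_sym.
Qed.

Lemma degree_induced (V : finType) (G : sgraph V) (S : {set V})
    (x : {x : V | x \in S}) : degree (induced G S) x = #|nbrs G (val x) :&: S|.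
Proof.
rewrite /degree -(card_imset _ val_inj); congr #|pred_of_set _|.
apply/setP=> u; apply/imsetP/idP => [[y]|].
  by rewrite !inE => xy ->; apply/andP; split=> //; apply: valP.
by rewrite !inE => /andP[xu uS]; exists (exist _ u uS); rewrite ?inE.
Qed.

(** Density of G[A] at an admissible size gives average degree at least d |A|. *)
Lemma dense_vertex (R : realType) (V : finType) (G : sgraph V) (zeta d : R)
    (A : {set V}) : dense G zeta d -> zeta * #|V|%:R <= #|A|%:R ->
  (0 < #|A|)%N -> exists2 v, v \in A & d * #|A|%:R <= #|nbrs G v :&: A|%:R.
Proof.
move=> dG /dG dA A0; apply/exists_inP; apply: contraLR dA => /exists_inPn small.
rewrite -ltNge ltr_pdivlMr// -natrM.
apply: (@le_lt_trans _ _ (\sum_(x : {x | x \in A}) degree (induced G A) x)%:R).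
  by rewrite ler_nat mulnC num_edges_le.
have [u0 u0A] : exists u, u \in A by apply/set0Pn; rewrite -card_gt0.
rewrite natr_sum; apply: (@lt_le_trans _ _ (\sum_(x : {x | x \in A}) d * #|A|%:R)).
  apply: ltr_sum => [|x _]; last by rewrite degree_induced ltNge small ?(valP x).
  by apply/hasP; exists (exist _ u0 u0A); rewrite ?mem_index_enum.
by rewrite sumr_const card_sig -[leLHS]mulr_natr -mulrA -expr2.
Qed.

(** * The selection procedure *)

(** The sets counted by the theorem that are still possible after some steps of
the selection procedure: T are the vertices known to be in the set, and A is the
container of those not yet decided. *)
Definition low_degree_sets (V : finType) (G : sgraph V) (D s : nat)
    (A T : {set V}) : {set {set V}} :=
  [set U : {set V} | [&& #|U| == s, T \subset U, U \subset T :|: A &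
    [forall u in U, #|nbrs G u :&: U| < D]%N]].

(** The average residual capacity D - w over A, corrected by a logarithm so that
discarding vertices never increases it. *)
Definition potential (R : realType) (V : finType) (D : nat) (A : {set V})
    (w : V -> nat) : R :=
  (\sum_(u in A) (D%:R - (w u)%:R)) / #|A|%:R + D%:R * ln #|A|%:R.

(** What the selection procedure guarantees after choosing T with container A.
The weight w u counts the selected neighbours of u that were selected while u was
still in the container; it stops growing once u is discarded, so that it is at
most D. Two quantities measure progress: the total weight, to which every
selection adds at least d m, and the potential, which every selection decreases
by at least d. *)
Record fingerprint (R : realType) (V : finType) (G : sgraph V) (D m : nat) (d : R)
    (A T : {set V}) (w : V -> nat) : Prop := Fingerprint {
  fp_disjoint : [disjoint T & A];
  fp_le : forall u, (w u <= D)%N;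
  fp_lt : forall u, u \in A -> (w u < D)%N;
  fp_nbrs : forall u, (w u <= #|nbrs G u :&: T|)%N;
  fp_sum : d * #|T|%:R * m%:R <= (\sum_u w u)%:R;
  fp_potential : (0 < #|A|)%N ->
    d * #|T|%:R + potential R D A w <= D%:R + D%:R * ln #|V|%:R
}.

Lemma potential_sub (R : realType) (V : finType) (D : nat) (A A' : {set V})
    (w : V -> nat) : A' \subset A -> (0 < #|A'|)%N -> (forall u, w u <= D)%N ->
  potential R D A' w <= potential R D A w.
Proof.
move=> sA A'0 wD.
have pos u : 0 <= D%:R - (w u)%:R :> R by rewrite subr_ge0 ler_nat.
have a'0 : 0 < #|A'|%:R :> R by rewrite ltr0n.
have a'a : #|A'|%:R <= #|A|%:R :> R by rewrite ler_nat subset_leq_card.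
have a0 : 0 < #|A|%:R :> R by apply: lt_le_trans a'a.
rewrite /potential; set P' := \sum_(u in A') _; set P := \sum_(u in A) _.
(* The average of D - w passes from P/|A| to P'/|A'|, where P' <= P; as the new
   average is at most D, the logarithm absorbs the increase. *)
have P'P : P' <= P.
  rewrite /P (big_setID A')/= (setIidPr sA) lerDl; exact: sumr_ge0.
have P'D : P' <= D%:R * #|A'|%:R.
  rewrite mulr_natr -sumr_const; apply: ler_sum => u _.
  by rewrite gerBl.
have lnA : 1 - #|A'|%:R / #|A|%:R <= ln #|A|%:R - ln #|A'|%:R :> R.
  rewrite -ln_div ?posrE//; apply: le_trans (ln_ge1BV _); last by rewrite divr_gt0.
  by rewrite invf_div.
apply: le_trans (_ : P' / #|A|%:R + D%:R * ln #|A|%:R <= _); last first.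
  by rewrite lerD2r ler_wpM2r// invr_ge0 ltW.
set rho := #|A'|%:R / #|A|%:R in lnA.
have rho1 : rho <= 1 by rewrite /rho ler_pdivrMr// mul1r.
have -> : P' / #|A|%:R = P' / #|A'|%:R * rho by rewrite /rho; field; rewrite !lt0r_neq0.
have phiD : P' / #|A'|%:R <= D%:R by rewrite ler_pdivrMr.
have D0 : 0 <= D%:R :> R by [].
have := ler_wpM2l D0 lnA.
have : 0 <= (D%:R - P' / #|A'|%:R) * (1 - rho) by rewrite mulr_ge0 ?subr_ge0.
lra.
Qed.

Lemma fingerprint_discard (R : realType) (V : finType) (G : sgraph V) (D m : nat)
    (d : R) (A A' T : {set V}) (w : V -> nat) :
  fingerprint G D m d A T w -> A' \subset A -> fingerprint G D m d A' T w.
Proof.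
case=> dj wD wlt wn ws wp sA; split=> // [|u /(subsetP sA)/wlt//|A'0].
  by apply: disjointWr sA dj.
have A0 : (0 < #|A|)%N by apply: leq_trans A'0 (subset_leq_card sA).
by apply: le_trans (wp A0); rewrite lerD2l potential_sub.
Qed.

(** Selecting a vertex v with d |A| neighbours in A raises the weight of these
neighbours by 1; those reaching weight D leave the container along with v. *)
Lemma fingerprint_select (R : realType) (V : finType) (G : sgraph V) (D m : nat)
    (d : R) (A T : {set V}) (w : V -> nat) (v : V) : 0 <= d ->
  fingerprint G D m d A T w -> (m <= #|A|)%N -> v \in A ->
  d * #|A|%:R <= #|nbrs G v :&: A|%:R ->
  let w' := fun u => (w u + (u \in nbrs G v :&: A))%N in
  fingerprint G D m d [set u in A :\ v | w' u < D]%N (v |: T) w'.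
Proof.
move=> d0 [dj wD wlt wn ws wp] mA vA dv w'.
set A' := [set u in A :\ v | _].
have vT : v \notin T by rewrite (disjointFl dj vA).
have sA : A' \subset A by apply/subsetP=> u; rewrite !inE => /andP[/andP[]].
have cT : #|v |: T|%:R = 1 + #|T|%:R :> R by rewrite cardsU1 vT natrD.
have w'D u : (w' u <= D)%N.
  rewrite /w' inE; case uA : (u \in A); last by rewrite andbF addn0.
  by apply: leq_trans (wlt u uA); rewrite -addn1 leq_add2l leq_b1.
have sum_incr (P : pred V) : (forall u, u \in A -> P u) ->
    (\sum_(u | P u) w' u = \sum_(u | P u) w u + #|nbrs G v :&: A|)%N.
  move=> AP; rewrite big_split/=; congr addn; rewrite -sum1_card.
  rewrite [RHS]big_mkcond [LHS]big_mkcond; apply: eq_bigr => u _.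
  rewrite inE; case uA : (u \in A); first by rewrite AP//; case: (u \in _).
  by rewrite andbF; case: ifP.
split=> //.
- rewrite disjoints_subset subUset sub1set -disjoints_subset !inE eqxx/=.
  exact: disjointWr sA dj.
- by move=> u; rewrite inE => /andP[].
- move=> u; rewrite /w' addnC; apply: leq_trans (leq_add (leqnn _) (wn u)) _.
  case uv: (u \in nbrs G v :&: A); last by rewrite subset_leq_card// setIS ?subsetUr.
  have vu : v \in nbrs G u :&: (v |: T).
    by move: uv; rewrite !inE eqxx adj_sym => /andP[->].
  rewrite (cardsD1 v (_ :&: (_ |: _))) vu leq_add2l subset_leq_card//.
  rewrite subsetD1 inE (negPf vT) andbF.
  by rewrite setIS ?subsetUr.
- rewrite cT mulrDr mulr1 mulrDl sum_incr// natrD addrC.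
  rewrite lerD//; apply: le_trans dv; rewrite ler_wpM2l// ler_nat//.
- move=> A'0.
  have A0 : (0 < #|A|)%N by apply: leq_trans A'0 (subset_leq_card sA).
  apply: le_trans (wp A0); rewrite cT mulrDr mulr1 [d + _]addrC -addrA lerD2l.
  apply: le_trans (_ : d + potential R D A w' <= _).
    by rewrite lerD2l potential_sub.
  rewrite /potential addrA lerD2r -lerBrDr -mulrBl ler_pdivlMr ?ltr0n//.
  rewrite -sumrB; apply: le_trans dv _.
  rewrite (eq_bigr (fun u => (w' u)%:R - (w u)%:R)) => [|u _]; last by ring.
  by rewrite sumrB -!natr_sum sum_incr// natrD addrAC subrr add0r.
Qed.

(** * Counting sets of low degree *)

Lemma card_supersets_le (V : finType) (T : {set V}) (F P : {set {set V}}) :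
  (forall U, U \in F -> T \subset U /\ U :\: T \in P) -> (#|F| <= #|P|)%N.
Proof.
move=> FP; rewrite -(@card_in_imset _ _ (fun U => U :\: T) (mem F)).
  by apply/subset_leq_card/subsetP=> _ /imsetP[U /FP[_ ?] ->].
move=> U U' /FP[TU _] /FP[TU' _] eqD.
by rewrite -(setID U T) -(setID U' T) eqD (setIidPr TU) (setIidPr TU').
Qed.

(** The selection procedure, phrased as a recursion on the container. The
binomial coefficient in |A| counts the possible ways to complete the fingerprint,
and the other one bounds the sets with a given fingerprint; the last hypothesis is
this bound for fingerprints completed while the container is still large. *)
Lemma card_low_degree_sets (R : realType) (V : finType) (G : sgraph V)
    (D m f s : nat) (d : R) : 0 <= d -> (f <= s)%N ->
  (forall A : {set V}, (m < #|A|)%N ->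
     exists2 v, v \in A & d * #|A|%:R <= #|nbrs G v :&: A|%:R) ->
  (forall A T w, fingerprint G D m d A T w -> #|T| = f -> (m < #|A|)%N ->
     #|low_degree_sets G D s A T| <= 'C(m, s - f))%N ->
  forall A T w, fingerprint G D m d A T w -> (#|T| <= f)%N ->
  (#|low_degree_sets G D s A T| <= 'C(#|A|, f - #|T|) * 'C(m, s - f))%N.
Proof.
move=> d0 fs richV leaf A; have [k] := ubnP #|A|.
elim: k A => // k IHk A Ak T w st Tf.
have [Am|mA] := leqP #|A| m.
  (* The container is small enough: any choice of the s - |T| remaining
     vertices inside A is allowed. *)
  apply: (@leq_trans ('C(#|A|, (f - #|T|) + (s - f)))).
    rewrite -cards_draws; apply: (@card_supersets_le _ T) => U.
    rewrite !inE => /and4P[/eqP Us TU UA _]; split=> //.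
    rewrite subDset UA cardsD (setIidPr TU) Us; apply/eqP; lia.
  apply: leq_trans (binD_le _ _ _) _.
  by rewrite leq_mul// leq_bin2l.
have [Tf'|] := leqP f #|T|.
  have eqT : #|T| = f by apply/eqP; rewrite eqn_leq Tf.
  by rewrite eqT subnn bin0 mul1n; apply: leaf st _ _.
move=> {}Tf; have [v vA dv] := richV A mA.
have vT : v \notin T by rewrite (disjointFl (fp_disjoint st) vA).
have st1 := fingerprint_discard st (subD1set A v).
have := fingerprint_select d0 st (ltnW mA) vA dv.
set w' := (fun u => _); move=> /=; set A' := [set u in _ | _] => st2.
have cA : #|A| = (#|A :\ v|).+1 by rewrite (cardsD1 v A) vA.
have cT : #|v |: T| = #|T|.+1 by rewrite cardsU1 vT.
have sA' : (#|A'| <= #|A :\ v|)%N.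
  by apply/subset_leq_card/subsetP=> u; rewrite inE => /andP[].
have b1 := IHk (A :\ v) _ T w st1 (ltnW Tf).
have b2 := IHk A' _ (v |: T) w' st2.
have {}b1 : (#|low_degree_sets G D s (A :\ v) T| <= _)%N := b1 ltac:(lia).
have {}b2 : (#|low_degree_sets G D s A' (v |: T)| <= _)%N := b2 ltac:(lia) ltac:(lia).
(* Either v is not in U, or v joins the fingerprint and A loses v together with
   the vertices that now have D neighbours in the fingerprint. *)
apply: (@leq_trans (#|low_degree_sets G D s (A :\ v) T| +
                    #|low_degree_sets G D s A' (v |: T)|)).
  apply: leq_trans (leq_card_setU _ _); apply/subset_leq_card/subsetP=> U.
  rewrite !inE => /and4P[-> TU UA low]; rewrite TU low /= andbT.
  case vU : (v \in U); last first.
    apply/orP; left; apply/subsetP=> u uU.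
    move: (subsetP UA _ uU); rewrite !inE => /orP[->//|->]; rewrite andbT.
    by case: eqP uU => [->|]; rewrite ?vU ?orbT.
  apply/orP; right; rewrite subUset sub1set vU TU/= andbT.
  apply/subsetP=> u uU; move: (subsetP UA _ uU).
  rewrite !inE => /orP[->|uA]; first by rewrite orbT.
  case: eqP => //= _; rewrite uA /=; apply/orP; right.
  apply: leq_ltn_trans (fp_nbrs st2 u) _.
  apply: leq_ltn_trans (forall_inP low u uU).
  by rewrite subset_leq_card// setIS// subUset sub1set vU.
apply: leq_trans (leq_add b1 b2) _; rewrite -mulnDl leq_mul2r; apply/orP; right.
rewrite cA cT -[(f - #|T|)%N]prednK ?subn_gt0// binS subnS leq_add2l.
exact: leq_bin2l.
Qed.

(** If the container is still large after f selections, then the potential,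
which dropped by d f = 4 D log2 (n/m), is still at least D ln m. As it started
at D + D ln n, the ratio n/m must be small. *)
Lemma fingerprint_exhausted (R : realType) (V : finType) (G : sgraph V)
    (D m : nat) (d : R) (A T : {set V}) (w : V -> nat) :
  fingerprint G D m d A T w -> (0 < m)%N -> (m < #|A|)%N -> (0 < D)%N ->
  d * #|T|%:R = 4 * D%:R * (ln (#|V|%:R / m%:R) / ln 2) ->
  (10 * #|V| <= 13 * m)%N.
Proof.
move=> st m0 mA D0 dT; rewrite leqNgt; apply/negP=> mn.
have A0 : (0 < #|A|)%N by apply: leq_trans mA.
have M0 : 0 < m%:R :> R by rewrite ltr0n.
have N0 : 0 < #|V|%:R :> R by rewrite ltr0n; apply: leq_trans A0 (max_card _).
have D0' : 0 < D%:R :> R by rewrite ltr0n.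
have lnA : ln m%:R <= ln #|A|%:R :> R by rewrite ler_ln ?posrE ?ltr0n// ler_nat ltnW.
have pot : D%:R * ln m%:R <= potential R D A w.
  apply: le_trans (_ : D%:R * ln #|A|%:R <= _); first by rewrite ler_wpM2l// ltW.
  rewrite lerDr divr_ge0// sumr_ge0// => u _.
  by rewrite subr_ge0 ler_nat (fp_le st).
have := fp_potential st A0; rewrite dT ln_div ?posrE// => hp.
set l := ln #|V|%:R - ln m%:R in hp.
(* 3/13 is 1 - m/n at n = 13m/10, and 40/7 * l > 1 + l as soon as l >= 3/13. *)
have l_ge : 3 / 13 <= l.
  rewrite /l -ln_div ?posrE//; apply: le_trans (ln_ge1BV _); last by rewrite divr_gt0.
  rewrite invf_div lerBrDr -lerBrDl ler_pdivrMr//.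
  have : 13 * m%:R <= 10 * #|V|%:R :> R by rewrite -!natrM ler_nat ltnW.
  by move=> ?; lra.
have l2 : 10 / 7 * l <= l / ln 2 by apply: ln_div_ln2_ge; lra.
have : 4 * D%:R * (l / ln 2) <= D%:R * (1 + l).
  have -> : D%:R * (1 + l) = D%:R + D%:R * ln #|V|%:R - D%:R * ln m%:R.
    by rewrite /l; ring.
  lra.
rewrite mulrAC mulrC ler_pM2l//; lra.
Qed.

Lemma sum_weights_le (V : finType) (G : sgraph V) (D s : nat) (A T U : {set V})
    (w : V -> nat) : (forall u, (w u <= #|nbrs G u :&: T|)%N) ->
  U \in low_degree_sets G D s A T -> (\sum_(u in U) w u <= #|T| * D)%N.
Proof.
move=> wn; rewrite inE => /and4P[_ TU _ /forall_inP low].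
(* Count the edges between T and U from the side of T. *)
apply: (@leq_trans (\sum_(u in U) \sum_(t in T | adj G u t) 1)).
  apply: leq_sum => u _; apply: leq_trans (wn u) _.
  rewrite sum1_card subset_leq_card//; apply/subsetP=> t.
  by rewrite !inE unfold_in andbC.
rewrite (exchange_big_dep (mem T))/=; last by move=> u t _ /andP[].
rewrite -sum_nat_const; apply: leq_sum => t tT.
apply: leq_trans (ltnW (low t (subsetP TU t tT))).
rewrite sum1_card subset_leq_card//; apply/subsetP=> u.
by rewrite !inE unfold_in adj_sym => /and3P[-> _ ->].
Qed.

(** For n/m close to 1 the container may well stay large, since a vertex not
yet examined leaves it only after receiving D selected neighbours. But then V has
total weight at least d f m, whereas a set of low degree containing T has weight at most D f,
which is atypically small for a set of size s; [light_subsets_le] with k = 2x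
turns this into the same bound as a container of size m. *)
Lemma card_low_degree_sets_heavy (R : realType) (V : finType) (G : sgraph V)
    (D m x f s : nat) (d : R) (A T : {set V}) (w : V -> nat) :
  fingerprint G D m d A T w -> #|T| = f -> #|V| = (m + x)%N -> (0 < D)%N ->
  d * f%:R = 4 * D%:R * (ln (#|V|%:R / m%:R) / ln 2) ->
  (f < x)%N -> (10 * x <= 3 * m)%N -> (f * (m + x) < s * x)%N -> (f <= s)%N ->
  (#|low_degree_sets G D s A T| <= 'C(m, s - f))%N.
Proof.
move=> st Tf cV D0 df fx xm fsx fles.
have [->|[U0 U0F]] := set_0Vmem (low_degree_sets G D s A T); first by rewrite cards0.
have TD U : U \in low_degree_sets G D s A T ->
    (\sum_(u in U :\: T) w u + \sum_(u in T) w u <= f * D)%N.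
  move=> UF; have := sum_weights_le (fp_nbrs st) UF; rewrite Tf.
  move: UF; rewrite inE => /and4P[_ TU _ _].
  by rewrite (big_setID T)/= (setIidPr TU) addnC.
(* The weight of T itself appears both in the weight of its complement and in
   the allowance q left for U minus T, and cancels in wV. *)
pose L : R := D%:R * (2 * x%:R + 2 * x%:R ^+ 2 / m%:R - f%:R).
pose q : R := f%:R * D%:R - (\sum_(u in T) w u)%:R.
have X0 : 0 < x%:R :> R by rewrite ltr0n; lia.
have M0 : 0 < m%:R :> R by rewrite ltr0n; lia.
have D0' : 0 < D%:R :> R by rewrite ltr0n.
have FX : f%:R < x%:R :> R by rewrite ltr_nat.
have q0 : 0 <= q.
  by rewrite subr_ge0 -natrM ler_nat; have := TD _ U0F; lia.
have L0 : 0 < L.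
  have : 0 <= 2 * x%:R ^+ 2 / m%:R :> R by rewrite divr_ge0// mulr_ge0// sqr_ge0.
  by move=> ?; rewrite /L; apply: mulr_gt0 => //; lra.
have wV : L + q + (2 * x)%:R * D%:R <= (\sum_(u in ~: T) w u)%:R + D%:R.
  have sumT : (\sum_u w u = \sum_(u in T) w u + \sum_(u in ~: T) w u)%N.
    by rewrite (bigID (mem T))/=; congr addn; apply: eq_bigl => u; rewrite ?in_setC.
  have := fp_sum st; rewrite Tf df sumT natrD => hsum.
  (* In terms of t = x/m the weight of V is at least 4 D m log2 (1 + t), hence
     at least D m (4 t + 2 t^2). *)
  have lnt : 7 / 10 * (x%:R / m%:R + (x%:R / m%:R) ^+ 2 / 2) <=
      ln (#|V|%:R / m%:R) :> R.
    have -> : #|V|%:R / m%:R = 1 + x%:R / m%:R :> R.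
      by rewrite cV natrD; field; rewrite lt0r_neq0.
    apply: ln1D_ge.
    rewrite divr_ge0//= ler_pdivrMr//.
    have : 10 * x%:R <= 3 * m%:R :> R by rewrite -!natrM ler_nat.
    by move=> ?; lra.
  have key : 4 * x%:R + 2 * x%:R ^+ 2 / m%:R <=
      4 * (ln (#|V|%:R / m%:R) / ln 2) * m%:R :> R.
    have log_ge : 10 / 7 * ln (#|V|%:R / m%:R) <= ln (#|V|%:R / m%:R) / ln 2 :> R.
      apply: ln_div_ln2_ge; apply: ln_ge0.
      by rewrite ler_pdivlMr// mul1r ler_nat cV leq_addr.
    have h2 : x%:R / m%:R + (x%:R / m%:R) ^+ 2 / 2 <=
        ln (#|V|%:R / m%:R) / ln 2 :> R by lra.
    have := ler_wpM2r (ltW M0) h2.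
    rewrite (_ : (x%:R / m%:R + (x%:R / m%:R) ^+ 2 / 2) * m%:R =
             x%:R + x%:R ^+ 2 / m%:R / 2).
      lra.
    by field; rewrite lt0r_neq0.
  have := ler_wpM2l (ltW D0') key.
  rewrite /L /q natrM; lra.
have cB : #|~: T| = (m + x - f)%N by rewrite -cV -Tf -(cardsC T) addKn.
have := @light_subsets_le R V w D q L (s - f) (2 * x) (~: T) (fp_le st) q0 L0 wV.
rewrite cB => light; rewrite -(ler_nat R).
have qL : q / L * (2 * x%:R + 2 * x%:R ^+ 2 / m%:R - f%:R) <= f%:R.
  have -> : (2 * x%:R + 2 * x%:R ^+ 2 / m%:R - f%:R) = L / D%:R.
    by rewrite /L [RHS]mulrAC divff ?mul1r// lt0r_neq0.
  rewrite mulrA divfK ?lt0r_neq0// ler_pdivrMr//.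
  by rewrite /q gerBl.
apply: le_trans (expn_mul_bin_le fx xm fsx fles (divr_ge0 q0 (ltW L0)) qL).
apply: le_trans light; rewrite ler_nat.
apply: (@card_supersets_le _ T) => U UF; have := TD _ UF.
move: UF; rewrite !inE => /and4P[/eqP Us TU _ _] wU; split=> //.
rewrite subsetDr cardsD (setIidPr TU) Us Tf eqxx /=.
by rewrite /q lerBrDr -natrM -natrD ler_nat.
Qed.

Lemma max_degree_induced_lt (V : finType) (G : sgraph V) (D : nat) (U : {set V}) :
  (max_degree (induced G U) < D)%N ->
  forall u, u \in U -> (#|nbrs G u :&: U| < D)%N.
Proof.
move=> low u uU; apply: leq_ltn_trans low.
have := leq_bigmax (F := degree (induced G U)) (exist _ u uU).
by rewrite degree_induced.
Qed.

(** * Low-degree sets in dense graphs *)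

Theorem lemma1p1 (R : realType) (n : nat) (n_ge1 : (1 <= n)%N)
    (zeta d : R) (zeta_gt0 : 0 < zeta) (d_gt0 : 0 < d)
    (V : finType) (G : sgraph V) (card_V : #|V| = n) (denseG : dense G zeta d)
    (D : nat) (D_ge1 : (1 <= D)%N)
    (f : nat) (fE : f%:R = 4 * D%:R / d * log2 (1 / zeta))
    (m : nat) (mE : m%:R = zeta * n%:R)
    (s : nat) (s_ge : (f <= s)%N) :
  (#|[set U : {set V} | (#|U| == s) && (max_degree (induced G U) < D)]|
     <= 'C(n, f) * 'C(m, s - f))%N.
Proof.
set F := [set U | _].
have N0 : 0 < n%:R :> R by rewrite ltr0n.
have D0 : 0 < D%:R :> R by rewrite ltr0n.
have m0 : (0 < m)%N by rewrite -(ltr0n R) mE mulr_gt0.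
have M0 : 0 < m%:R :> R by rewrite ltr0n.
have ln2_gt0 : 0 < ln 2 :> R by rewrite ln_gt0// ltr1n.
(* The form in which the choice of f is used: zeta is m / n. *)
have df : d * f%:R = 4 * D%:R * (ln (n%:R / m%:R) / ln 2).
  rewrite fE /log2 mE (_ : n%:R / (zeta * n%:R) = 1 / zeta).
    by field; rewrite !lt0r_neq0.
  by field; rewrite !lt0r_neq0.
have mn : (m <= n)%N.
  have l0 : 0 <= ln (n%:R / m%:R) :> R.
    have : 0 <= 4 * D%:R * (ln (n%:R / m%:R) / ln 2) :> R.
      by rewrite -df mulr_ge0// ltW.
    by rewrite pmulr_rge0 ?mulr_gt0// pmulr_lge0 ?invr_gt0.
  rewrite -(ler_nat R) leNgt; apply/negP=> nm; move: l0; rewrite leNgt ln_lt0//.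
  by rewrite divr_gt0//= ltr_pdivrMr// mul1r.
have [x cV] : exists x, n = (m + x)%N by exists (n - m)%N; rewrite subnKC.
have [triv|nontriv] := leqP (s * x) (f * n.+1).
  apply: (@leq_trans 'C(n, s)).
    rewrite -card_V -card_draws subset_leq_card//; apply/subsetP=> U.
    by rewrite !inE => /andP[].
  by have := bin_le_mul_bin s_ge triv; rewrite cV addnK; apply; rewrite leq_addl.
have [ns|sn] := ltnP n s.
  rewrite (_ : F = set0) ?cards0//; apply/setP=> U; rewrite !inE.
  apply/negbTE/negP=> /andP[/eqP Us _].
  by have := max_card (mem U); rewrite Us card_V leqNgt ns.
(* f >= x would give s * x <= f * s <= f * n. *)
have fx : (f < x)%N by nia.
have FG : (#|F| <= #|low_degree_sets G D s setT set0|)%N.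
  apply/subset_leq_card/subsetP=> U; rewrite !inE => /andP[-> low].
  rewrite sub0set set0U subsetT/=; apply/forall_inP; exact: max_degree_induced_lt.
apply: leq_trans FG _.
have start : fingerprint G D m d [set: V] set0 (fun=> 0%N).
  split=> //.
  - by rewrite disjoints_subset sub0set.
  - by rewrite cards0 mulr0 mul0r.
  - rewrite cards0 mulr0 add0r /potential subr0 sumr_const => c0.
    rewrite -[D%:R *+ _]mulr_natr mulfK ?cardsT//.
    by rewrite lt0r_neq0// ltr0n -cardsT.
have := @card_low_degree_sets R V G D m f s d (ltW d_gt0) s_ge _ _ _ _ _ start.
rewrite cards0 subn0 cardsT card_V; apply=> // [A mA|A T w st Tf mA].
  apply: (dense_vertex denseG); last by apply: leq_trans mA.
  by rewrite card_V -mE ler_nat ltnW.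
have df' : d * #|T|%:R = 4 * D%:R * (ln (#|V|%:R / m%:R) / ln 2).
  by rewrite Tf card_V df.
have := fingerprint_exhausted st m0 mA D_ge1 df'; rewrite card_V => xm.
apply: card_low_degree_sets_heavy st Tf _ _ _ fx _ _ _ => //; try lia.
by rewrite card_V.
Qed.
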